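(* Let $A\in\mathbb F^{n\times n}$ with $A^H=A$, let $B\in\mathbb F^{m\times n}$ have rank $r$, and let $M=\begin{bmatrix} A & B^H \\ B & 0\end{bmatrix}$. Let $P^TB^HQ=LU$ be a rank-revealing LU factorization: $P\in\{0,1\}^{n\times n}$ and $Q\in\{0,1\}^{m\times m}$ are permutation matrices, $L\in\mathbb F^{n\times r}$ is lower trapezoidal with unit diagonal, and $U\in\mathbb F^{r\times m}$ is upper trapezoidal with nonzero diagonal. Write $L=\begin{bmatrix}L_1 \\ L_2\end{bmatrix}$ with $L_1\in\mathbb F^{r\times r}$ and $P^TAP=\begin{bmatrix}A_{11}&A_{12} \\ A_{21}&A_{22}\end{bmatrix}$ with $A_{11}\in\mathbb F^{r\times r}$, and define $$W=L_1^{-1}A_{11}L_1^{-H},\quad D=-\operatorname{diag}(W),\quad Y_1=L_1\operatorname{tril}(W)+D,$$ $$Y_2=\bigl(A_{21}-L_2((Y_1^H-D)+DL_1^H)\bigr)L_1^{-H},\quad Y=\begin{bmatrix}Y_1 \\ Y_2\end{bmatrix}.$$ Then $P,Q,Y,L,U,D$ form a constraint-complemented partial LDL factorization of $M$. Moreover, they are the same constraint-complemented partial LDL factorization as the one obtained by carrying out the corresponding $\Gamma$-elimination sequence on $M$ (i.e. the sequence with the row and column pivots determined by $P$ and $Q$).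
   Context: $\mathbb F$ is an arbitrary field with a fixed involution $a\mapsto a^*$ (a field automorphism with $(a^* )^*=a$; it may be the identity). For a matrix $X$, $X^H$ is the matrix with $(X^H)_{ij}=x_{ji}^*$, and $X^{-H}=(X^{-1})^H$. $\operatorname{diag}(W)$ denotes the diagonal matrix with the diagonal of $W$, and $\operatorname{tril}(W)$ is the lower triangular part of $W$ including the diagonal. Constraint-complemented partial LDL. Let $M=\begin{bmatrix}A&B^H \\ B&0\end{bmatrix}$ with $A\in\mathbb F^{n\times n}$, $A^H=A$, and $B\in\mathbb F^{m\times n}$ of rank $r$. It consists of $D\in\mathbb F^{r\times r}$, $L,Y\in\mathbb F^{n\times r}$, $U\in\mathbb F^{r\times m}$ and permutation matrices $P\in\{0,1\}^{n\times n}$, $Q\in\{0,1\}^{m\times m}$, where $D$ is diagonal with $D^H=D$, $L$ is lower trapezoidal with unit diagonal, $Y=\begin{bmatrix}Y_1 \\ Y_2\end{bmatrix}$ is lower trapezoidal with zero diagonal and $Y_1\in\mathbb F^{r\times r}$, $U$ is upper trapezoidal with nonzero diagonal, such that for $V=\begin{bmatrix}Y_1-D \\ Y_2\end{bmatrix}$, $$\begin{bmatrix}P&0 \\ 0&Q\end{bmatrix}^TM\begin{bmatrix}P&0 \\ 0&Q\end{bmatrix}=\begin{bmatrix}V&L \\ U^H&0\end{bmatrix}\begin{bmatrix}0&I \\ I&D\end{bmatrix}\begin{bmatrix}V&L \\ U^H&0\end{bmatrix}^H+\begin{bmatrix}P^TAP-VL^H-LV^H-LDL^H&0 \\ 0&0\end{bmatrix},$$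 and $P^TAP-VL^H-LV^H-LDL^H$ is nonzero only in its lower right $(n-r)\times(n-r)$ block. $\Gamma$-elimination sequence with pivots given by $P,Q$. Start with $A^{(0)}=P^TAP$, $B^{(0)}=Q^TBP$. At step $k=1,\dots,r$, write $a=A^{(k-1)}$, $b=B^{(k-1)}$, use the nonzero pivot $b_{kk}$, and set $d_{kk}=-a_{kk}$; the $k$th column of $Y$ equal to $a_{:,k}-e_ka_{kk}$; the $k$th column of $L$ equal to $b_{k,:}^H/b_{kk}^*$; the $k$th row of $U$ equal to $b_{:,k}^H$; $$A^{(k)}=a-a_{:,k}b_{kk}^{-1}b_{k,:}-b_{k,:}^H(b_{kk}^* )^{-1}a_{:,k}^H+b_{k,:}^Ha_{kk}(b_{kk}^*b_{kk})^{-1}b_{k,:},\qquad B^{(k)}=b-b_{:,k}b_{kk}^{-1}b_{k,:}.$$ The resulting $D=\operatorname{diag}(d_{11},\dots,d_{rr})$, $Y$, $L$, $U$, together with $P,Q$, are the factors obtained from $\Gamma$-elimination. Here $x_{:,k}$ and $x_{k,:}$ denote the $k$th column and $k$th row of a matrix $x$. *)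

(* Defs.v *)
From mathcomp Require Export all_boot all_algebra.
Set Implicit Arguments.
Unset Strict Implicit.
Unset Printing Implicit Defensive.
Import GRing.Theory.
Local Open Scope ring_scope.
Local Open Scope sesquilinear_scope.

(* An n x n matrix A and an m x n matrix B of rank r are written with          *)
(* n = r + p and m = r + q, so that the leading r x r blocks and the k-th      *)
(* diagonal entries (k : 'I_r) are reached by ulsubmx, lshift p, lshift q.   *)
(* The conjugate transpose X^H is X ^t conj.                                   *)

Definition trilmx (R : nmodType) (n : nat) (W : 'M[R]_n) : 'M[R]_n :=
  \matrix_(i, j) if (j <= i)%N then W i j else 0.

Definition diag_part (R : nmodType) (n : nat) (W : 'M[R]_n) : 'M[R]_n :=
  diag_mx (\row_i W i i).

Definition unit_lower_trap (R : nzRingType) (r p : nat) (L : 'M[R]_(r + p, r)) :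
    Prop :=
  is_trig_mx L /\ forall k : 'I_r, L (lshift p k) k = 1.

Definition zero_lower_trap (R : nmodType) (r p : nat) (Y : 'M[R]_(r + p, r)) :
    Prop :=
  is_trig_mx Y /\ forall k : 'I_r, Y (lshift p k) k = 0.

Definition nonzero_upper_trap (R : nmodType) (r q : nat)
    (U : 'M[R]_(r, r + q)) : Prop :=
  is_trig_mx U^T /\ forall k : 'I_r, U k (lshift q k) != 0.

Record rank_revealing_LU (F : fieldType) (r p q : nat)
    (X : 'M[F]_(r + p, r + q)) (P : 'M[F]_(r + p)) (Q : 'M[F]_(r + q))
    (L : 'M[F]_(r + p, r)) (U : 'M[F]_(r, r + q)) : Prop := {
  rrLU_P : is_perm_mx P;
  rrLU_Q : is_perm_mx Q;
  rrLU_L : unit_lower_trap L;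
  rrLU_U : nonzero_upper_trap U;
  rrLU_eq : P^T *m X *m Q = L *m U
}.

Section ConstraintComplemented.

Variables (F : fieldType) (conj : {rmorphism F -> F}) (r p q : nat).
Variables (A : 'M[F]_(r + p)) (B : 'M[F]_(r + q, r + p)).
Variables (P : 'M[F]_(r + p)) (Q : 'M[F]_(r + q)).

Definition saddle_mx : 'M[F]_((r + p) + (r + q)) :=
  block_mx A (B ^t conj) B 0.

Definition LDL_V (D : 'M[F]_r) (Y : 'M[F]_(r + p, r)) : 'M[F]_(r + p, r) :=
  col_mx (usubmx Y - D) (dsubmx Y).

Definition LDL_residual (D : 'M[F]_r) (Y L : 'M[F]_(r + p, r)) :
    'M[F]_(r + p) :=
  let V := LDL_V D Y in
  P^T *m A *m P - V *m L ^t conj - L *m V ^t conj - L *m D *m L ^t conj.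

Record cc_partial_LDL (D : 'M[F]_r) (Y L : 'M[F]_(r + p, r))
    (U : 'M[F]_(r, r + q)) : Prop := {
  LDL_P : is_perm_mx P;
  LDL_Q : is_perm_mx Q;
  LDL_D_diag : is_diag_mx D;
  LDL_D_herm : D ^t conj = D;
  LDL_L : unit_lower_trap L;
  LDL_Y : zero_lower_trap Y;
  LDL_U : nonzero_upper_trap U;
  LDL_eq :
    let PQ := block_mx P 0 0 Q in
    let N := block_mx (LDL_V D Y) L (U ^t conj) 0 in
    PQ^T *m saddle_mx *m PQ
      = N *m block_mx 0 1%:M 1%:M D *m N ^t conj
        + block_mx (LDL_residual D Y L) 0 0 0;
  LDL_residual_ul : ulsubmx (LDL_residual D Y L) = 0;
  LDL_residual_ur : ursubmx (LDL_residual D Y L) = 0;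
  LDL_residual_dl : dlsubmx (LDL_residual D Y L) = 0
}.

Definition gamma_step (ab : 'M[F]_(r + p) * 'M[F]_(r + q, r + p)) (k : 'I_r) :
    'M[F]_(r + p) * 'M[F]_(r + q, r + p) :=
  let: (a, b) := ab in
  let i := lshift q k in
  let j := lshift p k in
  (a - (b i j)^-1 *: (col j a *m row i b)
     - (conj (b i j))^-1 *: ((row i b) ^t conj *m (col j a) ^t conj)
     + (a j j * (conj (b i j) * b i j)^-1) *: ((row i b) ^t conj *m row i b),
   b - (b i j)^-1 *: (col j b *m row i b)).

(* gamma_seq k = (A^(k), B^(k)) for k <= r, constant afterwards; step k of the *)
(* 1-based elimination is the one with 0-based pivot index k.-1.               *)
Fixpoint gamma_seq (k : nat) : 'M[F]_(r + p) * 'M[F]_(r + q, r + p) :=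
  if k is k'.+1 then
    if (insub k' : option 'I_r) is Some i then gamma_step (gamma_seq k') i
    else gamma_seq k'
  else (P^T *m A *m P, Q^T *m B *m P).

Definition gamma_A (k : nat) : 'M[F]_(r + p) := (gamma_seq k).1.
Definition gamma_B (k : nat) : 'M[F]_(r + q, r + p) := (gamma_seq k).2.

(* As 0^-1 = 0 in F, gamma_seq is total; the elimination is genuinely carried  *)
(* out exactly when none of its pivots vanishes.                               *)
Definition gamma_pivots_nonzero : Prop :=
  forall k : 'I_r, gamma_B k (lshift q k) (lshift p k) != 0.

Definition gamma_D : 'M[F]_r :=
  diag_mx (\row_(k < r) - gamma_A k (lshift p k) (lshift p k)).

Definition gamma_Y : 'M[F]_(r + p, r) :=
  \matrix_(i < r + p, k < r)
    (col (lshift p k) (gamma_A k)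
     - gamma_A k (lshift p k) (lshift p k) *: delta_mx (lshift p k) 0) i 0.

Definition gamma_L : 'M[F]_(r + p, r) :=
  \matrix_(i < r + p, k < r)
    ((conj (gamma_B k (lshift q k) (lshift p k)))^-1
     *: (row (lshift q k) (gamma_B k)) ^t conj) i 0.

Definition gamma_U : 'M[F]_(r, r + q) :=
  \matrix_(k < r, j < r + q) ((col (lshift p k) (gamma_B k)) ^t conj) 0 j.

End ConstraintComplemented.

(* Main.v *)
(** By the rank-revealing LU, Q^T B P = U^H L^H is the sum of the rank-one
    terms u_t^H l_t^H. Given any constraint-complemented partial LDL, Gamma-step k
    strips exactly the k-th rank-one contribution from both matrices: triangularity
    makes the k-th row and column of what is left collapse to the k-th columns of
    V, L and row of U, so every such factorization is the one produced by
    Gamma-elimination. The given formulas are a factorization because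
    W = tril(W) + tril(W)^H - diag(W) for Hermitian W. *)
Require Import Defs.
From mathcomp Require Import ring.
Set Implicit Arguments.
Unset Strict Implicit.
Unset Printing Implicit Defensive.
Import GRing.Theory.
Local Open Scope ring_scope.
Local Open Scope sesquilinear_scope.

(** * Conjugate transposes, triangular parts and the entries of one elimination step *)

Lemma trmxC_invol (R : nzRingType) (conj : {rmorphism R -> R}) (m n : nat)
    (X : 'M[R]_(m, n)) :
  involutive conj -> (X ^t conj) ^t conj = X.
Proof. by move=> conjK; apply/matrixP => i j; rewrite !mxE conjK. Qed.

Lemma trmxC_mul (R : comNzRingType) (conj : {rmorphism R -> R}) (m n l : nat)
    (X : 'M[R]_(m, n)) (Z : 'M[R]_(n, l)) :
  (X *m Z) ^t conj = Z ^t conj *m X ^t conj.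
Proof. by rewrite trmx_mul map_mxM. Qed.

Lemma trmxC_perm (R : nzRingType) (conj : {rmorphism R -> R}) (n : nat)
    (P : 'M[R]_n) : is_perm_mx P -> P ^t conj = P^T.
Proof. by case/is_perm_mxP => s ->; rewrite tr_perm_mx map_perm_mx. Qed.

Lemma trmxC_diag_part (R : nzRingType) (conj : {rmorphism R -> R}) (n : nat)
    (W : 'M[R]_n) : W ^t conj = W -> (diag_part W) ^t conj = diag_part W.
Proof.
move=> hW; apply/matrixP => i j; rewrite !mxE eq_sym.
case: eqVneq => [->|_]; rewrite ?mulr0n ?raddf0 // !mulr1n.
by rewrite -[in RHS]hW !mxE.
Qed.

(** Off the diagonal exactly one of the two triangular parts contributes; on it both do, so the
    diagonal is subtracted once. *)
Lemma trilmx_trmxC (R : nzRingType) (conj : {rmorphism R -> R}) (n : nat)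
    (W : 'M[R]_n) : W ^t conj = W ->
  trilmx W + (trilmx W) ^t conj - diag_part W = W.
Proof.
move=> hW; apply/matrixP => i j; rewrite !mxE.
have hWC k l : conj (W k l) = W l k by rewrite -[in RHS]hW !mxE.
case: (ltngtP i j) => [ij|ji|/val_inj ->].
- by rewrite -val_eqE /= (ltn_eqF ij) hWC subr0 add0r.
- by rewrite -val_eqE /= (gtn_eqF ji) raddf0 subr0 addr0.
- by rewrite eqxx mulr1n hWC addrK.
Qed.

(** Scalar form of a step, in which [field] can compare it with the contribution of a single
    index. *)
Lemma gamma_stepE (F : fieldType) (conj : {rmorphism F -> F}) (r p q : nat)
    (a : 'M[F]_(r + p)) (b : 'M[F]_(r + q, r + p)) (k : 'I_r) :
  let i0 := lshift q k in
  let j0 := lshift p k in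
  gamma_step conj (a, b) k =
  (\matrix_(i, j) (a i j - (b i0 j0)^-1 * (a i j0 * b i0 j)
     - (conj (b i0 j0))^-1 * (conj (b i0 i) * conj (a j j0))
     + a j0 j0 * (conj (b i0 j0) * b i0 j0)^-1 * (conj (b i0 i) * b i0 j)),
   \matrix_(i, j) (b i j - (b i0 j0)^-1 * (b i j0 * b i0 j))).
Proof.
by rewrite /gamma_step; congr (_, _); apply/matrixP => i j;
   rewrite !mxE !big_ord1 !mxE.
Qed.

Section GammaElimination.

Variables (F : fieldType) (conj : {rmorphism F -> F}).
Hypothesis conjK : involutive conj.
Variables (r p q : nat).
Variables (A : 'M[F]_(r + p)) (B : 'M[F]_(r + q, r + p)).
Variables (P : 'M[F]_(r + p)) (Q : 'M[F]_(r + q)).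
Variables (D : 'M[F]_r) (Y L : 'M[F]_(r + p, r)) (U : 'M[F]_(r, r + q)).

(** * Block forms of the two sides of the factorization identity *)

Lemma saddle_mx_perm :
  is_perm_mx P -> is_perm_mx Q ->
  let PQ := block_mx P 0 0 Q in
  PQ^T *m saddle_mx conj A B *m PQ =
  block_mx (P^T *m A *m P) (P^T *m B ^t conj *m Q) (Q^T *m B *m P) 0.
Proof.
move=> hP hQ /=; rewrite /saddle_mx tr_block_mx !trmx0 !mulmx_block.
by rewrite !(mul0mx, mulmx0, add0r, addr0).
Qed.

(** For [V = LDL_V D Y] the upper left block is exactly what [LDL_residual] subtracts, so the only
    real content of the block identity is $P^TB^HQ=LU$. *)
Lemma LDL_factors_mul (V : 'M[F]_(r + p, r)) :
  let N := block_mx V L (U ^t conj) 0 in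
  N *m block_mx 0 1%:M 1%:M D *m N ^t conj =
  block_mx (V *m L ^t conj + L *m V ^t conj + L *m D *m L ^t conj) (L *m U)
           ((L *m U) ^t conj) 0.
Proof.
rewrite /= tr_block_mx map_block_mx !mulmx_block trmxC_invol // !trmx0 !map_mx0.
rewrite !(mul0mx, mulmx0, mulmx1, add0r, addr0) -trmxC_mul mulmxDl addrA.
by rewrite [L *m _ + _]addrC.
Qed.

(** * Every partial LDL factorization is reproduced by the elimination *)

Section FromFactorization.

Hypothesis hF : cc_partial_LDL conj A B P Q D Y L U.

Let V := LDL_V D Y.
Let hL1 (k : 'I_r) : L (lshift p k) k = 1.
Proof. by case: (LDL_L hF). Qed.
Let hL0 (k t : 'I_r) : (k < t)%N -> L (lshift p k) t = 0.
Proof. by move=> kt; case: (LDL_L hF) => /is_trig_mxP -> . Qed.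
Let hU0 (k t : 'I_r) : (k < t)%N -> U t (lshift q k) = 0.
Proof.
move=> kt; case: (LDL_U hF) => /is_trig_mxP h _.
by have := h (lshift q k) t kt; rewrite mxE.
Qed.
Let hD (k : 'I_r) : conj (D k k) = D k k.
Proof. by rewrite -[in RHS](LDL_D_herm hF) !mxE. Qed.
Let VE (i : 'I_(r + p)) (k : 'I_r) :
  V i k = Y i k - (i == lshift p k)%:R * D k k.
Proof.
rewrite /V /LDL_V mxE; case: split_ordP => j ->; rewrite !mxE; last first.
  by rewrite eq_rlshift mul0r subr0.
rewrite eq_lshift; case: eqVneq => [->|jk]; first by rewrite mul1r.
by rewrite (is_diag_mxP (LDL_D_diag hF)) // mul0r.
Qed.
Let hVkk (k : 'I_r) : V (lshift p k) k = - D k k.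
Proof. by rewrite VE eqxx mul1r; case: (LDL_Y hF) => _ ->; rewrite sub0r. Qed.
Let hV0 (k t : 'I_r) : (k < t)%N -> V (lshift p k) t = 0.
Proof.
move=> kt; rewrite VE eq_lshift -val_eqE /= (ltn_eqF kt) mul0r subr0.
by case: (LDL_Y hF) => /is_trig_mxP ->.
Qed.

Let res := LDL_residual conj A P D Y L.

Let res_col (i : 'I_(r + p)) (k : 'I_r) : res i (lshift p k) = 0.
Proof.
rewrite -[res]submxK (LDL_residual_ul hF) (LDL_residual_dl hF).
by rewrite block_mxEv mxE; case: split => j; rewrite row_mxEl mxE.
Qed.

(** Contribution of index [t] to $VL^H+LV^H+LDL^H$; a single index suffices because $D$ is
    diagonal. *)
Let Aterm (i j : 'I_(r + p)) (t : 'I_r) : F :=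
  V i t * conj (L j t) + L i t * conj (V j t) + L i t * D t t * conj (L j t).
Let Bterm (i : 'I_(r + q)) (j : 'I_(r + p)) (t : 'I_r) : F :=
  conj (U t i) * conj (L j t).

(* What is left of the matrices after k steps is the part of the factorization *)
(* carried by the indices t >= k.                                              *)
Let Arem (k : nat) : 'M[F]_(r + p) :=
  \matrix_(i, j) (res i j + \sum_(t < r | (k <= t)%N) Aterm i j t).
Let Brem (k : nat) : 'M[F]_(r + q, r + p) :=
  \matrix_(i, j) \sum_(t < r | (k <= t)%N) Bterm i j t.

Let sum_tail (f : 'I_r -> F) (k : 'I_r) :
  \sum_(t < r | (k <= t)%N) f t = f k + \sum_(t < r | (k < t)%N) f t.
Proof.
rewrite (bigD1 k) //=; congr (_ + _); apply: eq_bigl => t.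
by rewrite ltn_neqAle andbC -val_eqE eq_sym.
Qed.

(** Row [k] of both $L$ and $V$ vanishes in the columns [t > k]. In the term [t = k] the diagonal
    entry $-d_{kk}$ of $V$ cancels the contribution of $LDL^H$, which is why $D$ is subtracted in
    $V$. *)
Let Arem_col (k : 'I_r) (i : 'I_(r + p)) : Arem k i (lshift p k) = V i k.
Proof.
rewrite mxE res_col add0r sum_tail big1 => [|t kt]; last first.
  by rewrite /Aterm hL0 // hV0 // raddf0; ring.
by rewrite /Aterm hL1 hVkk rmorph1 rmorphN hD; ring.
Qed.

Let Brem_col (k : 'I_r) (i : 'I_(r + q)) :
  Brem k i (lshift p k) = conj (U k i).
Proof.
rewrite mxE sum_tail big1 => [|t kt]; last by rewrite /Bterm hL0 // raddf0 mulr0.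
by rewrite /Bterm hL1 rmorph1 mulr1 addr0.
Qed.

Let Brem_row (k : 'I_r) (j : 'I_(r + p)) :
  Brem k (lshift q k) j = conj (U k (lshift q k)) * conj (L j k).
Proof.
rewrite mxE sum_tail big1 ?addr0 // => t kt.
by rewrite /Bterm hU0 // raddf0 mul0r.
Qed.

Let pivot_neq0 (k : 'I_r) : U k (lshift q k) != 0.
Proof. by case: (LDL_U hF). Qed.

(** The pivot is $u_{kk}^*$ and the pivot row is $u_{kk}^*$ times the conjugated column [k] of $L$,
    so the pivot cancels; as $a_{kk}=-d_{kk}$, the step removes precisely [Aterm] and [Bterm] at
    [k]. *)
Let gamma_step_rem (k : 'I_r) :
  gamma_step conj (Arem k, Brem k) k = (Arem k.+1, Brem k.+1).
Proof.
have u0 := pivot_neq0 k.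
have cu0 : conj (U k (lshift q k)) != 0 by rewrite fmorph_eq0.
rewrite gamma_stepE; congr (_, _); apply/matrixP => i j; rewrite [LHS]mxE.
  rewrite !Arem_col !Brem_row hL1 hVkk rmorph1 mulr1 !rmorphM !conjK.
  rewrite [Arem k i j]mxE [Arem k.+1 i j]mxE sum_tail /Aterm.
  by field; rewrite u0 cu0.
rewrite !Brem_col !Brem_row.
rewrite [Brem k i j]mxE [Brem k.+1 i j]mxE sum_tail /Bterm.
by field.
Qed.

Let gamma_seq_rem (k : nat) :
  (k <= r)%N -> gamma_seq conj A B P Q k = (Arem k, Brem k).
Proof.
elim: k => [_|k IHk kr]; last first.
  rewrite -(gamma_step_rem (Ordinal kr)) -IHk 1?ltnW //.
  (* Going from [k] to [k.+1] uses the pivot index [k], a valid ordinal since [k < r]. *)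
  by rewrite [LHS]/= insubT.
(* At [k = 0] the sums are complete: the residual plus the full product gives back $P^TAP$, and the
   lower left block of the identity gives $Q^TBP$. *)
have sumE (f : 'I_r -> F) : \sum_(t < r | (0 <= t)%N) f t = \sum_t f t by [].
have hB : Q^T *m B *m P = (L *m U) ^t conj.
  have := LDL_eq hF; rewrite /= (saddle_mx_perm (LDL_P hF) (LDL_Q hF)).
  by rewrite LDL_factors_mul add_block_mx !addr0 => /eq_block_mx[].
congr (_, _); apply/matrixP => i j; rewrite [RHS]mxE sumE; last first.
  rewrite hB trmxC_mul mxE; apply: eq_bigr => t _.
  by rewrite !mxE.
rewrite !big_split /= /res /LDL_residual -/V.
have -> : \sum_t V i t * conj (L j t) = (V *m L ^t conj) i j.
  by rewrite mxE; apply: eq_bigr => t _; rewrite !mxE.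
have -> : \sum_t L i t * conj (V j t) = (L *m V ^t conj) i j.
  by rewrite mxE; apply: eq_bigr => t _; rewrite !mxE.
have -> : \sum_t L i t * D t t * conj (L j t) = (L *m D *m L ^t conj) i j.
  rewrite mxE; apply: eq_bigr => t _; rewrite !mxE (bigD1 t) //= big1 ?addr0 //.
  by move=> s st; rewrite (is_diag_mxP (LDL_D_diag hF)) ?mulr0.
by rewrite !mxE; ring.
Qed.

Let gamma_AE (k : 'I_r) : gamma_A conj A B P Q k = Arem k.
Proof. by rewrite /gamma_A gamma_seq_rem // ltnW. Qed.
Let gamma_BE (k : 'I_r) : gamma_B conj A B P Q k = Brem k.
Proof. by rewrite /gamma_B gamma_seq_rem // ltnW. Qed.

(** The factors are read off the pivot rows and columns of the remainders. As the sequence depends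
    only on $A,B,P,Q$, the factorization with given permutations is unique. *)
Lemma cc_partial_LDL_gamma :
  gamma_pivots_nonzero conj A B P Q /\
  [/\ D = gamma_D conj A B P Q, Y = gamma_Y conj A B P Q,
      L = gamma_L conj A B P Q & U = gamma_U conj A B P Q].
Proof.
have cu0 (k : 'I_r) : conj (U k (lshift q k)) != 0 by rewrite fmorph_eq0.
split; first by move=> k; rewrite gamma_BE Brem_col.
split; apply/matrixP => i j.
- rewrite !mxE gamma_AE Arem_col hVkk opprK.
  case: eqVneq => [->|ij]; first by rewrite mulr1n.
  by rewrite mulr0n (is_diag_mxP (LDL_D_diag hF)).
- rewrite !mxE gamma_AE !Arem_col hVkk VE eqxx andbT.
  by ring.
- rewrite !mxE gamma_BE !Brem_row rmorphM hL1 rmorphM !conjK mulr1.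
  by rewrite mulKf.
- by rewrite !mxE gamma_BE Brem_col conjK.
Qed.

End FromFactorization.

(** * The explicit formulas give a partial LDL factorization *)

Section FromLU.

Hypothesis hA : A ^t conj = A.
Hypothesis hLU : rank_revealing_LU (B ^t conj) P Q L U.

Let L1 : 'M[F]_r := usubmx L.
Let L2 : 'M[F]_(p, r) := dsubmx L.
Let A11 : 'M[F]_r := ulsubmx (P^T *m A *m P).
Let A21 : 'M[F]_(p, r) := dlsubmx (P^T *m A *m P).
Let W : 'M[F]_r := invmx L1 *m A11 *m (invmx L1) ^t conj.

Hypothesis hD : D = - diag_part W.
Let Y1 : 'M[F]_r := L1 *m trilmx W + D.
Hypothesis hY : Y = col_mx Y1
  ((A21 - L2 *m ((Y1 ^t conj - D) + D *m L1 ^t conj)) *m (invmx L1) ^t conj).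

Let L1_trig : is_trig_mx L1.
Proof.
case: (rrLU_L hLU) => /is_trig_mxP h _; apply/is_trig_mxP => i j ij.
by rewrite mxE h.
Qed.
Let L1_diag (k : 'I_r) : L1 k k = 1.
Proof. by case: (rrLU_L hLU) => _ h; rewrite mxE. Qed.

Let L1_unit : L1 \in unitmx.
Proof.
by rewrite unitmxE det_trig // big1 ?unitr1 // => k _; rewrite L1_diag.
Qed.

Let Ap : 'M[F]_(r + p) := P^T *m A *m P.

Let Ap_herm : Ap ^t conj = Ap.
Proof.
have hP := rrLU_P hLU.
by rewrite /Ap !trmxC_mul hA !trmxC_perm ?trmxK ?mulmxA // is_perm_mx_tr.
Qed.

Let A11_herm : A11 ^t conj = A11.
Proof. by rewrite /A11 trmx_ulsub map_ulsubmx Ap_herm. Qed.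

Let W_herm : W ^t conj = W.
Proof. by rewrite /W !trmxC_mul trmxC_invol // A11_herm mulmxA. Qed.

Let A11E : A11 = L1 *m W *m L1 ^t conj.
Proof.
rewrite /W !mulmxA mulmxV // mul1mx -mulmxA -trmxC_mul mulmxV //.
by rewrite trmx1 map_mx1 mulmx1.
Qed.

Let D_herm : D ^t conj = D.
Proof. by rewrite hD linearN /= map_mxN trmxC_diag_part. Qed.

Let L1_trilmx_trig : is_trig_mx (L1 *m trilmx W).
Proof.
apply/is_trig_mxP => i j ij; rewrite mxE big1 // => t _.
rewrite [trilmx W t j]mxE; case: leqP => [jt|_]; last by rewrite mulr0.
by rewrite (is_trig_mxP L1_trig) ?mul0r // (leq_trans ij).
Qed.

Let L1_trilmx_diag (k : 'I_r) : (L1 *m trilmx W) k k = W k k.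
Proof.
rewrite mxE (bigD1 k) //= big1 => [|t tk].
  by rewrite L1_diag mxE leqnn mul1r addr0.
rewrite [trilmx W t k]mxE; case: leqP => kt; last by rewrite mulr0.
by rewrite (is_trig_mxP L1_trig) ?mul0r // ltn_neqAle kt eq_sym tk.
Qed.

(** As $L_1$ has unit diagonal, $L_1\operatorname{tril}(W)$ has the diagonal of $W$, which
    $D=-\operatorname{diag}(W)$ cancels. *)
Let Y1_trig (i j : 'I_r) : (i <= j)%N -> Y1 i j = 0.
Proof.
rewrite /Y1 hD mxE leq_eqVlt => /orP[/eqP/val_inj <-|ij].
  by rewrite L1_trilmx_diag !mxE eqxx mulr1n subrr.
rewrite (is_trig_mxP L1_trilmx_trig) // !mxE -val_eqE /= (ltn_eqF ij).
by rewrite mulr0n oppr0 addr0.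
Qed.

Let Y_trig : zero_lower_trap Y.
Proof.
have Yle (i : 'I_(r + p)) (j : 'I_r) : (i <= j)%N -> Y i j = 0.
  case: (split_ordP i) => k -> ij; rewrite hY; first by rewrite col_mxEu Y1_trig.
  by move: ij; rewrite /= leqNgt ltn_addr.
by split=> [|k]; [apply/is_trig_mxP => i j ij; apply/Yle/ltnW | apply: Yle].
Qed.

Let res := LDL_residual conj A P D Y L.

(** Conjugate transposition swaps $VL^H$ and $LV^H$ and fixes the other terms. This lets the upper
    right block follow from the lower left one. *)
Let res_herm : res ^t conj = res.
Proof.
rewrite /res /LDL_residual; set V := LDL_V D Y.
rewrite !linearB /= !map_mxB -/Ap Ap_herm !trmxC_mul !trmxC_invol //.
by rewrite D_herm mulmxA; congr (_ - _); rewrite addrAC.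
Qed.

Let invL1HV : (invmx L1) ^t conj *m L1 ^t conj = 1%:M.
Proof. by rewrite -trmxC_mul mulmxV // trmx1 map_mx1. Qed.

(** The $D$ added in $Y_1$ is the one subtracted in $V$. *)
Let LDL_V_E : LDL_V D Y = col_mx (L1 *m trilmx W) (dsubmx Y).
Proof. by rewrite /LDL_V hY col_mxKu addrK. Qed.

Let LDL_D_mul : L *m D = col_mx (L1 *m D) (L2 *m D).
Proof. by rewrite -mul_col_mx vsubmxK. Qed.

Let res_ul : ulsubmx res = 0.
Proof.
rewrite /res /LDL_residual LDL_V_E LDL_D_mul -[L]vsubmxK -/L1 -/L2.
rewrite !tr_col_mx !map_row_mx !mul_col_row.
rewrite -[P^T *m A *m P]submxK !opp_block_mx !add_block_mx block_mxKul -/A11.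
(* Multiplying the splitting of $W$ by $L_1$ and $L_1^H$ turns its three summands into the upper
   left blocks of $VL^H$, $LV^H$ and $LDL^H$, and $W$ into $A_{11}$. *)
have /(congr1 (fun X => L1 *m X *m L1 ^t conj)) := trilmx_trmxC W_herm.
rewrite -A11E -hD mulmxDr mulmxDr !mulmxDl => <-.
rewrite trmxC_mul mulmxA; apply/eqP; rewrite !subr_eq add0r.
by rewrite -[X in X == _]addrA [X in X == _]addrC [X in X + _ == _]addrC.
Qed.

(** $Y_2$ is the solution of this block equation, with $Y_1^H-D$ standing for
    $(L_1\operatorname{tril}(W))^H$. *)
Let res_dl : dlsubmx res = 0.
Proof.
rewrite /res /LDL_residual LDL_V_E LDL_D_mul -[L]vsubmxK -/L1 -/L2.
rewrite !tr_col_mx !map_row_mx !mul_col_row.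
rewrite -[P^T *m A *m P]submxK !opp_block_mx !add_block_mx block_mxKdl -/A21.
rewrite hY col_mxKd -mulmxA invL1HV mulmx1 subKr.
have -> : (L1 *m trilmx W) ^t conj = Y1 ^t conj - D.
  by rewrite /Y1 linearD /= map_mxD D_herm addrK.
by rewrite mulmxDr mulmxA -addrA -opprD subrr.
Qed.

Let res_ur : ursubmx res = 0.
Proof. by rewrite -res_herm -map_ursubmx -trmx_dlsub res_dl trmx0 map_mx0. Qed.

(** The off-diagonal blocks are the LU identity and its conjugate transpose; the upper left block
    holds by the definition of the residual. *)
Lemma rank_revealing_LU_cc_partial_LDL : cc_partial_LDL conj A B P Q D Y L U.
Proof.
have [hP hQ hL hU hPBQ] := hLU.
have hQBP : Q^T *m B *m P = (L *m U) ^t conj.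
  rewrite -hPBQ !trmxC_mul trmxC_invol // trmxC_perm //.
  by rewrite trmxC_perm ?is_perm_mx_tr // trmxK mulmxA.
split=> //=.
  rewrite hD; apply/is_diag_mxP => i j ij.
  by rewrite !mxE -val_eqE /= (negbTE ij) mulr0n oppr0.
rewrite saddle_mx_perm // LDL_factors_mul add_block_mx !addr0 hQBP hPBQ.
by rewrite /LDL_residual -!addrA -!opprD 2!addrA -[X in X + (_ - _)]addrA subrKC.
Qed.

End FromLU.
End GammaElimination.

Theorem proposition3p2 (F : fieldType) (conj : {rmorphism F -> F})
    (conjK : involutive conj) (r p q : nat)
    (A : 'M[F]_(r + p)) (B : 'M[F]_(r + q, r + p))
    (hA : A ^t conj = A) (hB : \rank B = r)
    (P : 'M[F]_(r + p)) (Q : 'M[F]_(r + q))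
    (L : 'M[F]_(r + p, r)) (U : 'M[F]_(r, r + q))
    (hLU : rank_revealing_LU (B ^t conj) P Q L U) :
  let L1 : 'M[F]_r := usubmx L in
  let L2 : 'M[F]_(p, r) := dsubmx L in
  let A11 : 'M[F]_r := ulsubmx (P^T *m A *m P) in
  let A21 : 'M[F]_(p, r) := dlsubmx (P^T *m A *m P) in
  let W : 'M[F]_r := invmx L1 *m A11 *m (invmx L1) ^t conj in
  let D : 'M[F]_r := - diag_part W in
  let Y1 : 'M[F]_r := L1 *m trilmx W + D in
  let Y2 : 'M[F]_(p, r) :=
    (A21 - L2 *m ((Y1 ^t conj - D) + D *m L1 ^t conj)) *m (invmx L1) ^t conj in
  let Y : 'M[F]_(r + p, r) := col_mx Y1 Y2 in
  cc_partial_LDL conj A B P Q D Y L U /\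
  gamma_pivots_nonzero conj A B P Q /\
  [/\ D = gamma_D conj A B P Q, Y = gamma_Y conj A B P Q,
      L = gamma_L conj A B P Q & U = gamma_U conj A B P Q].
Proof.
move=> L1 L2 A11 A21 W D Y1 Y2 Y.
have hF : cc_partial_LDL conj A B P Q D Y L U.
  exact: rank_revealing_LU_cc_partial_LDL.
by split=> //; apply: cc_partial_LDL_gamma.
Qed.
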